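(* Let $w_k = \begin{bmatrix} a_k \\ b_k \\ c_k \end{bmatrix}$ with $a_k, c_k \in \mathbb{R}^n$, $b_k \in \mathbb{R}^m$ and $w_k^T s_k \neq 0$, and let $$ B_k = \begin{bmatrix} -Q & A^T & I \\ A & 0 & 0 \\ M^1_k & M^2_k & M^3_k \end{bmatrix} \in \mathbb{R}^{(2n+m)\times(2n+m)}, $$ where $M^1_k, M^3_k \in \mathbb{R}^{n\times n}$ and $M^2_k \in \mathbb{R}^{n\times m}$. Let $B_{k+1}$ be the least change secant update of $B_k$ (an approximation of $J_{k+1}$, the Jacobian of $F$ at $(x^{k+1},\lambda^{k+1},z^{k+1})$) given by $$ B_{k+1} = B_k + \frac{(y_k - B_k s_k) w_k^T}{w_k^T s_k}. $$ Then $$ B_{k+1} = \begin{bmatrix} -Q & A^T & I \\ A & 0 & 0 \\ M^1_{k+1} & M^2_{k+1} & M^3_{k+1} \end{bmatrix}, $$ where, for $i = 1,2,3$, $M^i_{k+1}$ is a rank-one update of $M^i_k$. In addition, if $M^2_k = 0$ and $b_k = 0$, then $M^2_{k+1} = 0$.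
   Context: Let $Q \in \mathbb{R}^{n\times n}$, $A \in \mathbb{R}^{m\times n}$ with linearly independent rows, $b \in \mathbb{R}^m$, $c \in \mathbb{R}^n$ be the data of the quadratic program $\min \frac12 x^TQx + c^Tx$ subject to $Ax=b$, $x \ge 0$. Define $F : \mathbb{R}^{2n+m} \to \mathbb{R}^{2n+m}$ by $$ F(x,\lambda,z) = \begin{bmatrix} -Qx + A^T\lambda + z - c \\ Ax - b \\ XZe \end{bmatrix}, \qquad x,z\in\mathbb{R}^n,\ \lambda\in\mathbb{R}^m, $$ where $X = \mathrm{diag}(x)$, $Z = \mathrm{diag}(z)$ and $e$ is the vector of ones. Its Jacobian is $$ J(x,\lambda,z) = \begin{bmatrix} -Q & A^T & I \\ A & 0 & 0 \\ Z & 0 & X \end{bmatrix}. $$ Let $(x^k,\lambda^k,z^k)$ and $(x^{k+1},\lambda^{k+1},z^{k+1})$ be two consecutive iterates of a primal-dual interior point method (so $x^k,z^k,x^{k+1},z^{k+1} > 0$ componentwise), and set $$ s_k = \begin{bmatrix} x^{k+1}-x^k \\ \lambda^{k+1}-\lambda^k \\ z^{k+1}-z^k \end{bmatrix}, \qquad y_k = F(x^{k+1},\lambda^{k+1},z^{k+1}) - F(x^k,\lambda^k,z^k). $$ A matrix $M'$ is called a rank-one update of a matrix $M$ of the same size if $M' = M + p q^T$ for some vectors $p, q$ (possibly zero). *)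

(* Defs.v *)
From mathcomp Require Export all_boot all_order all_algebra.
From mathcomp Require Export reals.
Set Implicit Arguments.
Unset Strict Implicit.
Unset Printing Implicit Defensive.
Import GRing.Theory Num.Theory.
Local Open Scope ring_scope.

(* R^(2n+m) is represented as 'cV[R]_(n + (m + n)), so that the blocks, of
   sizes n, m, n, are those of both (x, lambda, z) and F(x, lambda, z). *)
Definition stack3 (R : realType) (n m : nat)
    (u : 'cV[R]_n) (v : 'cV[R]_m) (w : 'cV[R]_n) : 'cV[R]_(n + (m + n)) :=
  col_mx u (col_mx v w).

(* [diag_mx] expects a row vector. *)
Definition diagc (R : realType) (n : nat) (x : 'cV[R]_n) : 'M[R]_n :=
  diag_mx x^T.

Definition kktF (R : realType) (n m : nat)
    (Q : 'M[R]_n) (A : 'M[R]_(m, n)) (b : 'cV[R]_m) (c : 'cV[R]_n)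
    (x : 'cV[R]_n) (lam : 'cV[R]_m) (z : 'cV[R]_n) : 'cV[R]_(n + (m + n)) :=
  stack3 (- (Q *m x) + A^T *m lam + z - c)
         (A *m x - b)
         (diagc x *m diagc z *m const_mx 1).

(* [ -Q A^T I ; A 0 0 ; M1 M2 M3 ].
   The Jacobian of [kktF Q A b c] at (x, lam, z) is the instance
   [kkt_mx Q A (diagc z) 0 (diagc x)]. *)
Definition kkt_mx (R : realType) (n m : nat)
    (Q : 'M[R]_n) (A : 'M[R]_(m, n))
    (M1 : 'M[R]_n) (M2 : 'M[R]_(n, m)) (M3 : 'M[R]_n) : 'M[R]_(n + (m + n)) :=
  col_mx (row_mx (- Q) (row_mx A^T 1%:M))
 (col_mx (row_mx A     (row_mx 0   0))
         (row_mx M1    (row_mx M2  M3))).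

Definition inner (R : realType) (p : nat) (u v : 'cV[R]_p) : R :=
  (u^T *m v) 0 0.

Definition secant_update (R : realType) (p : nat)
    (B : 'M[R]_p) (s y w : 'cV[R]_p) : 'M[R]_p :=
  B + (inner w s)^-1 *: ((y - B *m s) *m w^T).

(* The vectors may vanish, so M' = M is allowed. *)
Definition rank_one_update (R : realType) (p q : nat) (M M' : 'M[R]_(p, q)) :
    Prop :=
  exists (u : 'cV[R]_p) (v : 'cV[R]_q), M' = M + u *m v^T.

(* Main.v *)
Require Import Defs.
From mathcomp Require Import ring.
Import GRing.Theory Num.Theory.
Local Open Scope ring_scope.

(* The first two block rows of [kktF] are affine in (x, lambda, z), and those of
   B_k are their exact derivative, so the secant residual y_k - B_k s_k is
   supported in the last block.  The rank-one correction therefore only touches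
   the last block row, where it splits along the blocks of w_k. *)

Lemma kkt_mx_mul_stack3 (R : realType) (n m : nat)
  (Q : 'M[R]_n) (A : 'M[R]_(m, n)) (M1 : 'M[R]_n) (M2 : 'M[R]_(n, m))
  (M3 : 'M[R]_n) (u : 'cV[R]_n) (v : 'cV[R]_m) (w : 'cV[R]_n) :
  kkt_mx Q A M1 M2 M3 *m stack3 u v w =
  stack3 (- (Q *m u) + A^T *m v + w) (A *m u) (M1 *m u + M2 *m v + M3 *m w).
Proof.
by rewrite /kkt_mx /stack3 !mul_col_mx !mul_row_col mulNmx mul1mx !mul0mx
  !addr0 !addrA.
Qed.

(** The zero blocks of the left factor annihilate the first two block rows of the outer product; its
    last block row is [r] times each of [u^T], [v^T], [w^T]. *)
Lemma kkt_mx_add_last_row (R : realType) (n m : nat)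
  (Q : 'M[R]_n) (A : 'M[R]_(m, n)) (M1 : 'M[R]_n) (M2 : 'M[R]_(n, m))
  (M3 : 'M[R]_n) (r u : 'cV[R]_n) (v : 'cV[R]_m) (w : 'cV[R]_n) :
  kkt_mx Q A M1 M2 M3 + stack3 0 0 r *m (stack3 u v w)^T =
  kkt_mx Q A (M1 + r *m u^T) (M2 + r *m v^T) (M3 + r *m w^T).
Proof.
rewrite /kkt_mx /stack3 !tr_col_mx !mul_col_mx !mul0mx !add_col_mx !addr0.
by rewrite !mul_mx_row !add_row_mx.
Qed.

(** [M1], [M2], [M3] are arbitrary because [r] absorbs the whole third block, where the nonlinear
    part of [kktF] sits. *)
Lemma secant_residual_last_block (R : realType) (n m : nat)
  (Q : 'M[R]_n) (A : 'M[R]_(m, n)) (b : 'cV[R]_m) (c : 'cV[R]_n)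
  (x x' : 'cV[R]_n) (lam lam' : 'cV[R]_m) (z z' : 'cV[R]_n)
  (M1 : 'M[R]_n) (M2 : 'M[R]_(n, m)) (M3 : 'M[R]_n) :
  exists r : 'cV[R]_n,
    kktF Q A b c x' lam' z' - kktF Q A b c x lam z
      - kkt_mx Q A M1 M2 M3 *m stack3 (x' - x) (lam' - lam) (z' - z)
    = stack3 0 0 r.
Proof.
rewrite kkt_mx_mul_stack3 /kktF /stack3 !opp_col_mx !add_col_mx.
(* Matching the third blocks instantiates [r] by unification; the two goals left say that the upper
   blocks vanish. *)
eexists; congr col_mx; last congr col_mx.
- by rewrite !mulmxBr; apply/matrixP=> i j; rewrite !mxE; ring.
- by rewrite mulmxBr; apply/matrixP=> i j; rewrite !mxE; ring.
Qed.

Theorem lemma1 (R : realType) (n m : nat)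
  (Q : 'M[R]_n) (A : 'M[R]_(m, n)) (b : 'cV[R]_m) (c : 'cV[R]_n)
  (hA : row_free A)
  (xk : 'cV[R]_n) (lamk : 'cV[R]_m) (zk : 'cV[R]_n)
  (xk1 : 'cV[R]_n) (lamk1 : 'cV[R]_m) (zk1 : 'cV[R]_n)
  (hxk : forall i, 0 < xk i 0) (hzk : forall i, 0 < zk i 0)
  (hxk1 : forall i, 0 < xk1 i 0) (hzk1 : forall i, 0 < zk1 i 0)
  (ak : 'cV[R]_n) (bk : 'cV[R]_m) (ck : 'cV[R]_n)
  (M1k : 'M[R]_n) (M2k : 'M[R]_(n, m)) (M3k : 'M[R]_n) :
  let sk := stack3 (xk1 - xk) (lamk1 - lamk) (zk1 - zk) in
  let yk := kktF Q A b c xk1 lamk1 zk1 - kktF Q A b c xk lamk zk in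
  let wk := stack3 ak bk ck in
  let Bk := kkt_mx Q A M1k M2k M3k in
  let Bk1 := secant_update Bk sk yk wk in
  inner wk sk != 0 ->
  exists (M1k1 : 'M[R]_n) (M2k1 : 'M[R]_(n, m)) (M3k1 : 'M[R]_n),
    [/\ Bk1 = kkt_mx Q A M1k1 M2k1 M3k1,
        rank_one_update M1k M1k1,
        rank_one_update M2k M2k1,
        rank_one_update M3k M3k1
      & M2k = 0 /\ bk = 0 -> M2k1 = 0].
Proof.
move=> sk yk wk Bk Bk1 _.
have [r hr] := secant_residual_last_block _ _ _ Q A b c xk xk1 lamk lamk1
  zk zk1 M1k M2k M3k.
(* The scalar of the update is absorbed into the left vector, so one [q] serves all three blocks. *)
set q := (inner wk sk)^-1 *: r.
exists (M1k + q *m ak^T), (M2k + q *m bk^T), (M3k + q *m ck^T); split.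
(* The target is folded back into [Bk] plus one outer product with [wk], to be compared with the
   secant formula. *)
- rewrite -kkt_mx_add_last_row /Bk1 /secant_update /yk /Bk /sk hr.
  by rewrite scalemxAl /stack3 !scale_col_mx !scaler0.
- by exists q, ak.
- by exists q, bk.
- by exists q, ck.
- by case=> -> ->; rewrite trmx0 mulmx0 addr0.
Qed.
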